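(* Let $A$ be a local symmetric algebra over a field $K$ and let $X$ be a nontrivial twosided ideal of $A$ with $X\neq A$ (so $0\neq X\subsetneq A$). Then $\operatorname{Hom}_A(X,A/X)\neq 0$ and thus $\phi_X=1$, i.e. $\operatorname{Ext}^1_A(X,X)\neq 0$.
   Context: Algebras are finite dimensional, connected, non-semisimple and not isomorphic to $K[x]/(x^2)$; modules are finite dimensional right modules, and $X$ and $A/X$ are regarded as right $A$-modules. For a module $M$, $\phi_M:=\inf\{r\geq 1\mid \operatorname{Ext}^r_A(M,M)\neq 0\}$, with $\inf(\emptyset)=\infty$. *)

(* Defs.v *)
(* Mathematical Components; the MathComp-Analysis files boolp and functions
   are used for classical logic and for the additive group of functions. *)
From HB Require Import structures.
From mathcomp Require Import all_boot all_order all_algebra all_field.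
From mathcomp Require Import freeg.
From mathcomp Require Import boolp functions.

Set Implicit Arguments.
Unset Strict Implicit.
Unset Printing Implicit Defensive.

Import GRing.Theory.
Local Open Scope ring_scope.
Local Open Scope quotient_scope.

Definition nonzero (G : zmodType) : Prop := exists g : G, g != 0.

Section SubQuotient.
Variables (R : pzRingType) (V : lmodType R) (S : submodClosed V).

(* A copy of S carrying the instance [zmodClosed], which the library does not
   infer from [submodClosed]. *)
Definition submod_pred : {pred V} := S.
HB.instance Definition _ :=
  GRing.isSubmodClosed.Build R V submod_pred (GRing.subsemimodClosedP S).

Definition submod : Type := {x : V | x \in submod_pred}.
HB.instance Definition _ := SubChoice.on submod.
HB.instance Definition _ := [SubChoice_isSubLmodule of submod by <:].

Definition quotmod : Type := Quotient.quot submod_pred.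
HB.instance Definition _ := GRing.Zmodule.on quotmod.

Definition quotmod_pi (x : V) : quotmod := \pi_(Quotient.quot submod_pred) x.
Definition quotmod_scale (a : R) (q : quotmod) : quotmod :=
  quotmod_pi (a *: repr (q : Quotient.quot submod_pred)).

Lemma quotmod_piP x y : reflect (quotmod_pi x = quotmod_pi y) (x - y \in S).
Proof.
by rewrite -[_ \in S]/(_ \in submod_pred) Quotient.idealrBE; apply: eqP.
Qed.

Lemma quotmod_ind (P : quotmod -> Prop) : (forall x, P (quotmod_pi x)) ->
  forall q, P q.
Proof. by move=> Ppi; elim/quotW. Qed.

Lemma quotmod_piD : {morph quotmod_pi : x y / x + y}.
Proof. by move=> x y; rewrite /quotmod_pi !piE. Qed.

Lemma quotmod_scaleE a x : quotmod_scale a (quotmod_pi x) = quotmod_pi (a *: x).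
Proof.
apply/quotmod_piP; rewrite -scalerBr rpredZ //.
by apply/quotmod_piP; rewrite /quotmod_pi reprK.
Qed.

Fact quotmod_scaleA a b q :
  quotmod_scale a (quotmod_scale b q) = quotmod_scale (a * b) q.
Proof. by elim/quotmod_ind: q => x; rewrite !quotmod_scaleE scalerA. Qed.

Fact quotmod_scale1 : left_id 1 quotmod_scale.
Proof. by elim/quotmod_ind=> x; rewrite quotmod_scaleE scale1r. Qed.

Fact quotmod_scaleDr : right_distributive quotmod_scale +%R.
Proof.
move=> a; elim/quotmod_ind=> x; elim/quotmod_ind=> y.
by rewrite -quotmod_piD !quotmod_scaleE scalerDr quotmod_piD.
Qed.

Fact quotmod_scaleDl q : {morph quotmod_scale^~ q : a b / a + b}.
Proof.
move=> a b; elim/quotmod_ind: q => x.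
by rewrite !quotmod_scaleE scalerDl quotmod_piD.
Qed.

HB.instance Definition _ := GRing.Zmodule_isLmodule.Build R quotmod
  quotmod_scaleA quotmod_scale1 quotmod_scaleDr quotmod_scaleDl.

Fact quotmod_pi_linear : linear quotmod_pi.
Proof. by move=> a x y; rewrite quotmod_piD -quotmod_scaleE. Qed.
HB.instance Definition _ :=
  GRing.isLinear.Build R V quotmod _ quotmod_pi quotmod_pi_linear.

End SubQuotient.

Section KernelImage.
Variables (R : pzRingType) (U V : lmodType R) (f : {linear U -> V}).

Definition ker_pred : {pred U} := fun x => f x == 0.

Fact ker_pred_submod : subsemimod_closed ker_pred.
Proof.
split; first split; rewrite ?inE /in_mem /= /ker_pred ?linear0 //.
  by move=> x y; rewrite /in_mem /= linearD => /eqP-> /eqP->; rewrite addr0.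
by move=> a x /eqP fx0; rewrite /in_mem /= linearZ /= fx0 scaler0.
Qed.
HB.instance Definition _ :=
  GRing.isSubmodClosed.Build R U ker_pred ker_pred_submod.

End KernelImage.

Section Hom.
Variables (R : pzRingType) (U V : lmodType R).

Definition hom_pred : {pred U -> V} := fun f => `[< linear f >].

Fact hom_zmod_closed : zmod_closed hom_pred.
Proof.
split.
  by apply/asboolP=> a x y; rewrite -[RHS]/(a *: 0 + 0) scaler0 addr0.
move=> f g /asboolP lf /asboolP lg; apply/asboolP=> a x y.
by rewrite !fctE lf lg scalerBr addrACA opprD.
Qed.
HB.instance Definition _ :=
  GRing.isZmodClosed.Build (U -> V) hom_pred hom_zmod_closed.

Definition ModHom : Type := {f : U -> V | f \in hom_pred}.
HB.instance Definition _ := SubChoice.on ModHom.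
HB.instance Definition _ := [SubChoice_isSubZmodule of ModHom by <:].

End Hom.

Definition hom_of (R : pzRingType) (U V : lmodType R) (f : ModHom U V) :
  U -> V := val f.

Section HomComp.
Variables (R : pzRingType) (U' U V : lmodType R) (d : {linear U' -> U}).

Fact hom_comp_subproof (f : ModHom U V) : hom_of f \o d \in @hom_pred R U' V.
Proof.
have /asboolP lf := valP f.
by apply/asboolP=> a x y; rewrite /= linearP [LHS]lf.
Qed.

Definition hom_comp (f : ModHom U V) : ModHom U' V :=
  exist _ (hom_of f \o d) (hom_comp_subproof f).

Fact hom_comp_zmod_morphism : zmod_morphism hom_comp.
Proof. by move=> f g; apply/val_inj/funext. Qed.
HB.instance Definition _ :=
  GRing.isZmodMorphism.Build (ModHom U V) (ModHom U' V) hom_comp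
    hom_comp_zmod_morphism.

End HomComp.

Section FreeResolution.
Variable R : nzRingType.

Section Cover.
Variable M : lmodType R.

(* The free module on the underlying set of M, and the map onto M sending the
   basis element of m to m. *)
Definition free_cover : lmodType R := {freeg M / R}.

Definition cover_map (x : free_cover) : M := fglift (id : M -> M) x.

Fact cover_map_zmod_morphism : zmod_morphism cover_map.
Proof. exact: lift_is_additive. Qed.
HB.instance Definition _ :=
  GRing.isZmodMorphism.Build free_cover M cover_map cover_map_zmod_morphism.

Fact cover_map_scalable : scalable cover_map.
Proof.
move=> a x; rewrite -[in RHS](freeg_sumE x) -[a *: x]/(fgscale a x) /fgscale.
rewrite !raddf_sum; apply: eq_bigr => m _.
by rewrite /= /cover_map !liftU scalerA.
Qed.
HB.instance Definition _ :=
  GRing.isScalable.Build R free_cover M _ cover_map cover_map_scalable.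

Lemma cover_mapU (m : M) : cover_map << 1 *g m >> = m.
Proof. by rewrite /cover_map liftU scale1r. Qed.

Definition syzygy : lmodType R := submod (ker_pred cover_map).

End Cover.

Variable M : lmodType R.

(* The standard free resolution
     ... -> resolution 2 -> resolution 1 -> resolution 0 -> M -> 0
   in which resolution n is the free cover of the n-th iterated syzygy. *)
Definition nsyzygy (n : nat) : lmodType R := iter n syzygy M.

Definition resolution (n : nat) : lmodType R := free_cover (nsyzygy n).

Definition resolution_diff (n : nat) (x : resolution n.+1) : resolution n :=
  val (cover_map x : syzygy (nsyzygy n)).

Fact resolution_diff_linear n : linear (@resolution_diff n).
Proof. by move=> a x y; rewrite /resolution_diff linearP linearP. Qed.
HB.instance Definition _ n :=
  GRing.isLinear.Build R (resolution n.+1) (resolution n) _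
    (@resolution_diff n) (@resolution_diff_linear n).

Lemma resolution_exact0 (x : resolution 0) :
  cover_map x = 0 <-> exists y, x = resolution_diff y.
Proof.
split=> [x0|[y ->]]; last exact: eqP (valP (cover_map y)).
have kx : x \in submod_pred (ker_pred (@cover_map M)) by apply/eqP.
by exists (<< 1 *g (Sub x kx : syzygy M) >>);
  rewrite /resolution_diff cover_mapU.
Qed.

Lemma resolution_exact n (x : resolution n.+1) :
  resolution_diff x = 0 <-> exists y, x = resolution_diff y.
Proof.
have diff0 : resolution_diff x = 0 <-> cover_map x = 0.
  by split=> [x0|x0]; [apply: val_inj | rewrite /resolution_diff x0].
rewrite diff0; split=> [x0|[y ->]]; last exact: eqP (valP (cover_map y)).
have kx : x \in submod_pred (ker_pred (@cover_map (nsyzygy n.+1))) by apply/eqP.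
exists (<< 1 *g (Sub x kx : syzygy (nsyzygy n.+1)) >>).
by rewrite /resolution_diff cover_mapU.
Qed.

End FreeResolution.

Section Ext.
Variables (R : nzRingType) (M N : lmodType R).

Definition cochain (r : nat) : zmodType := ModHom (resolution M r) N.

Definition codiff (r : nat) : cochain r -> cochain r.+1 :=
  hom_comp (@resolution_diff R M r).
HB.instance Definition _ r := GRing.Additive.on (@codiff r).

Section Degree.
Variable r : nat.

Definition cocycle_pred : {pred cochain r} := fun c => codiff c == 0.

Fact cocycle_zmod_closed : zmod_closed cocycle_pred.
Proof.
split; rewrite ?inE /in_mem /= /cocycle_pred ?raddf0 //.
by move=> x y /eqP x0 /eqP y0; rewrite /in_mem /= raddfB /= x0 y0 subr0.
Qed.
HB.instance Definition _ :=
  GRing.isZmodClosed.Build (cochain r) cocycle_pred cocycle_zmod_closed.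

Definition cocycle : Type := {c : cochain r | c \in cocycle_pred}.
HB.instance Definition _ := SubChoice.on cocycle.
HB.instance Definition _ := [SubChoice_isSubZmodule of cocycle by <:].

End Degree.

Definition is_coboundary (r : nat) : cochain r -> Prop :=
  match r with
  | 0 => fun c => c = 0
  | r'.+1 => fun c => exists b : cochain r', c = codiff b
  end.

Definition coboundary_pred (r : nat) : {pred cocycle r} :=
  fun z => `[< is_coboundary (val z) >].

Fact coboundary_zmod_closed r : zmod_closed (@coboundary_pred r).
Proof.
case: r => [|r]; split.
- by apply/asboolP.
- move=> x y /asboolP x0 /asboolP y0; apply/asboolP.
  exact: etrans (congr2 (fun u v => u - v) x0 y0) (subr0 _).
- by apply/asboolP; exists 0; rewrite [RHS]raddf0.
- move=> x y /asboolP[b xb] /asboolP[c yc]; apply/asboolP; exists (b - c).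
  by rewrite [RHS]raddfB /= -xb -yc.
Qed.
HB.instance Definition _ r :=
  GRing.isZmodClosed.Build (cocycle r) (@coboundary_pred r)
    (@coboundary_zmod_closed r).

Definition Ext (r : nat) : zmodType := Quotient.quot (@coboundary_pred r).

End Ext.

Section Phi.
Variables (R : nzRingType) (M : lmodType R).

Definition self_ext (r : nat) : bool := (0 < r)%N && `[< nonzero (Ext M M r) >].

(* inf {r >= 1 | Ext^r(M, M) != 0}, with None standing for infinity. *)
Definition phi : option nat :=
  if pselect (exists r, self_ext r) is left ex then Some (ex_minn ex) else None.

End Phi.

(* Right A-modules are left modules over the converse ring A^c; the scaling
   a *: x of the regular module is then the product x * a of A. *)
Definition regular_right (A : nzRingType) : lmodType A^c := (A^c)^o.

Definition right_ideal (A : nzRingType) := submodClosed (regular_right A).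

Section Algebras.
Variable K : fieldType.

Definition maximal_right_ideal (A : falgType K) (I : right_ideal A) : Prop :=
  (exists x : A, x \notin I) /\
  forall J : right_ideal A,
    {subset I <= J} -> J =i I \/ (forall x : A, x \in J).

Definition local_alg (A : falgType K) : Prop :=
  exists I : right_ideal A, maximal_right_ideal I /\
    forall J : right_ideal A, maximal_right_ideal J -> J =i I.

(* A is isomorphic to its dual D(A) = Hom_K(A, K) as a bimodule, where
   (a f b)(y) = f (b y a). *)
Definition symmetric_alg (A : falgType K) : Prop :=
  exists Phi : 'Hom(A, 'Hom(A, K^o)), bijective Phi /\
    forall a x b y : A, Phi (a * x * b) y = Phi x (b * y * a).

Definition two_sided_ideal (A : falgType K) (I : right_ideal A) : Prop :=
  forall a x : A, x \in I -> a * x \in I.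

Definition connected_alg (A : falgType K) : Prop :=
  forall (B C : algType K) (f : {lrmorphism A -> (B * C)%type}), ~ bijective f.

Definition semisimple_alg (A : falgType K) : Prop :=
  forall I : right_ideal A, exists J : right_ideal A,
    (forall x : A, x \in I -> x \in J -> x = 0) /\
    forall x : A, exists y z : A, [/\ y \in I, z \in J & x = y + z].

Definition iso_dual_numbers (A : falgType K) : Prop :=
  exists f : {lrmorphism A -> {poly %/ ('X^2 : {poly K})}}, bijective f.

End Algebras.

(* Main.v *)
Require Import Defs.
From HB Require Import structures.
From mathcomp Require Import all_boot all_order all_algebra all_field.
From mathcomp Require Import freeg boolp functions.

Set Implicit Arguments.
Unset Strict Implicit.
Unset Printing Implicit Defensive.

Import GRing.Theory.
Local Open Scope ring_scope.

(** Nonvanishing of Hom(X, A/X).  A local algebra has a single simple right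
module S.  Finite dimension provides a right ideal Y that X covers and a right
ideal Z that covers X; then X/Y and Z/X are both isomorphic to S, and
X -> X/Y = S = Z/X -> A/X is a nonzero map ([local_hom_nonzero]).  In terms of
elements, x in X outside Y and z in Z outside X have the same annihilator
modulo Y and X respectively: both annihilators are maximal right ideals
([colon_maximal]), hence equal.  The map sends x a + y to the class of z a.

Nonvanishing of Ext^1(X, X).  A symmetrizing form makes A self-injective, in
the strong form that every right linear map from a right ideal X to A is left
multiplication by an element of A ([symmetric_ideal_hom]).  If X is two-sided,
such a map takes its values in X, so its composite with A -> A/X vanishes.
Hence no nonzero map X -> A/X lifts to A, and the connecting homomorphism from
Hom(X, A/X) to Ext^1(X, X) is injective ([ext1_nonzero]). *)

(** * Extensions from maps that do not lift *)

Lemma quotmod_pi_eq0 (R : pzRingType) (V : lmodType R) (S : submodClosed V)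
    (v : V) :
  (quotmod_pi S v == 0) = (v \in S).
Proof.
rewrite -(linear0 (quotmod_pi S)).
by apply/eqP/idP=> [/(@quotmod_piP _ _ S)|Sv];
  [|apply/(@quotmod_piP _ _ S)]; rewrite subr0.
Qed.

Section FreeLift.
Variables (R : nzRingType) (M V : lmodType R) (f : M -> V).

Definition free_lift (x : free_cover M) : V := fglift f x.

Lemma free_liftU a m : free_lift << a *g m >> = a *: f m.
Proof. exact: liftU. Qed.

Fact free_lift_zmod_morphism : zmod_morphism free_lift.
Proof. exact: lift_is_additive. Qed.
HB.instance Definition _ :=
  GRing.isZmodMorphism.Build (free_cover M) V free_lift
    free_lift_zmod_morphism.

Fact free_lift_scalable : scalable free_lift.
Proof.
move=> a x; rewrite -[in RHS](freeg_sumE x) -[a *: x]/(fgscale a x) /fgscale.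
rewrite !raddf_sum; apply: eq_bigr => m _.
by rewrite /= !free_liftU scalerA.
Qed.
HB.instance Definition _ :=
  GRing.isScalable.Build R (free_cover M) V _ free_lift free_lift_scalable.

End FreeLift.

Lemma free_cover_ext (R : nzRingType) (M V : lmodType R)
    (f g : {linear free_cover M -> V}) :
  (forall m : M, f << 1 *g m >> = g << 1 *g m >>) -> f =1 g.
Proof.
move=> fg x; rewrite -(freeg_sumE x) !raddf_sum; apply: eq_bigr => m _ /=.
have -> : << coeff m x *g m >> = coeff m x *: (<< 1 *g m >> : free_cover M).
  by apply/eqP/freeg_eqP => k; rewrite coeff_fgscale !coeffU mul1r.
by rewrite !linearZ fg.
Qed.

(** The connecting homomorphism Hom(M, V/S) -> Ext^1(M, S) kills only the maps
that lift to V.  Its value at g is computed on the free resolution of M: lift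
g to h : F_0 -> V; on the first syzygy h takes its values in S, and its
composite with F_1 -> F_0 is the cocycle c.  If c is the coboundary of
b : F_0 -> S, then h - b vanishes on the syzygy and so descends to a lift of g
to M. *)
Lemma ext1_nonzero (R : nzRingType) (M V : lmodType R) (S : submodClosed V)
    (g : {linear M -> quotmod S}) :
    (forall l : {linear M -> V}, ~ (forall m, quotmod_pi S (l m) = g m)) ->
  nonzero (Ext M (submod S) 1).
Proof.
move=> no_lift.
have lift_repr (q : quotmod S) : exists v, quotmod_pi S v = q.
  by elim/quotmod_ind: q => v; exists v.
pose h : {linear free_cover M -> V} :=
  free_lift (fun m => sval (cid (lift_repr (g m)))).
have hE x : quotmod_pi S (h x) = g (cover_map x).
  move: x; apply: (@free_cover_ext _ _ _ (quotmod_pi S \o h)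
                                   (g \o @cover_map _ M)) => m /=.
  rewrite cover_mapU free_liftU scale1r.
  by case: cid.
have hS (x : resolution M 1) : h (resolution_diff x) \in submod_pred S.
  rewrite -[_ \in _](@quotmod_pi_eq0 _ _ S) hE.
  rewrite (_ : cover_map _ = 0) ?linear0 //.
  by apply/resolution_exact0; exists x.
pose c0 (x : resolution M 1) : submod S := Sub (h (resolution_diff x)) (hS x).
have c0_hom : c0 \in @hom_pred R (resolution M 1) (submod S).
  by apply/asboolP=> a x y; apply: val_inj; rewrite /= !linearP.
pose c : cochain M (submod S) 1 := exist _ c0 c0_hom.
have c_cocycle : c \in @cocycle_pred R M (submod S) 1.
  apply/eqP/val_inj/funext => x; apply: val_inj => /=.
  rewrite (_ : resolution_diff _ = 0) ?linear0 //.
  by apply/resolution_exact; exists x.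
exists (\pi_(Quotient.quot _) (Sub c c_cocycle : cocycle M (submod S) 1))%qT.
apply/negP; rewrite -[0](raddf0 (\pi_(Quotient.quot _))%qT).
rewrite -Quotient.idealrBE subr0 => /asboolP[b /(congr1 val) /= cb].
have b_lin : linear (hom_of b) by apply/asboolP/(valP b).
pose bL : {linear free_cover M -> submod S} :=
  HB.pack (hom_of b) (GRing.isLinear.Build _ _ _ _ (hom_of b) b_lin).
pose k x := h x - val (bL x).
have k_ker x : cover_map x = 0 -> k x = 0.
  move=> /resolution_exact0[y ->]; apply/eqP; rewrite subr_eq0; apply/eqP.
  exact: (congr1 (fun F : resolution M 1 -> submod S => val (F y)) cb).
have kP : linear k.
  move=> a x y; rewrite /k (linearP h) (linearP bL).
  by rewrite (linearP (val : submod S -> V)) opprD addrACA scalerBr.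
pose kL : {linear free_cover M -> V} :=
  HB.pack k (GRing.isLinear.Build _ _ _ _ k kP).
(* The basis element of m is a preimage of m under the cover; k vanishes on
   the kernel of the cover, so the choice of preimage is immaterial. *)
pose l m := kL << 1 *g m >>.
have lE x : l (cover_map x) = kL x.
  apply/eqP; rewrite -subr_eq0 -linearB; apply/eqP/k_ker.
  by rewrite linearB /= cover_mapU subrr.
have lP : linear l.
  move=> a x y; rewrite -(cover_mapU x) -(cover_mapU y) -linearP !lE.
  by rewrite linearP.
apply: (no_lift (HB.pack l (GRing.isLinear.Build _ _ _ _ l lP))) => m /=.
rewrite /l /= /k linearB /= hE cover_mapU -[RHS]subr0; congr (_ - _).
by apply/eqP; rewrite quotmod_pi_eq0; apply: valP.
Qed.

(** * Right ideals and covers *)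

Section RightIdeals.
Variable A : nzRingType.
Implicit Types (J P Q : right_ideal A) (x y a : A).

Lemma right_ideal0 J : (0 : A) \in J.
Proof. exact: (rpred0 J). Qed.

Lemma right_idealD J x y : x \in J -> y \in J -> x + y \in J.
Proof. exact: (@rpredD _ J). Qed.

Lemma right_idealM J x a : x \in J -> x * a \in J.
Proof. exact: (@rpredZ _ _ J a x). Qed.

Lemma right_idealB J x y : x \in J -> y \in J -> x - y \in J.
Proof. by move=> Jx Jy; rewrite right_idealD // -mulrN1 right_idealM. Qed.

Lemma right_ideal_valD J (u v : submod J) :
  val (u + v) = (val u : A) + (val v : A) :> A.
Proof. exact: (raddfD (val : submod J -> regular_right A)). Qed.

(** The converse ring turns the scaling of the module J into multiplication on
the right in A. *)
Lemma right_ideal_valM J (b : A) (u : submod J) :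
  val ((b : A^c) *: u) = (val u : A) * b :> A.
Proof. exact: (linearZ_LR (val : submod J -> regular_right A)). Qed.

Lemma right_ideal_of (P : A -> Prop) :
    P 0 -> (forall x y, P x -> P y -> P (x + y)) ->
    (forall x a, P x -> P (x * a)) ->
  exists J, forall x : A, x \in J <-> P x.
Proof.
move=> P0 PD PM; pose S : {pred regular_right A} := fun x => `[< P x >].
have SP : subsemimod_closed S.
  split; first split; first exact/asboolP.
    by move=> x y /asboolP Px /asboolP Py; apply/asboolP/PD.
  by move=> a x /asboolP Px; apply/asboolP/PM.
pose J : right_ideal A :=
  HB.pack S (GRing.isSubmodClosed.Build _ (regular_right A) S SP).
by exists J => x; split=> [/asboolP|Px]; last exact/asboolP.
Qed.

Lemma not_right_ideal_sub P Q :
  ~ {subset P <= Q} -> exists2 x : A, x \in P & x \notin Q.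
Proof. by move/existsNP=> [x /not_implyP[Px /negP Qx]]; exists x. Qed.

Definition covers P Q : Prop :=
  [/\ {subset P <= Q}, exists2 x : A, x \in Q & x \notin P &
      forall J, {subset P <= J} -> {subset J <= Q} ->
        {subset J <= P} \/ {subset Q <= J}].

(** Q/P is simple, so it is generated by the class of x: the right ideal
x A + P contains P strictly. *)
Lemma covers_generated P Q x u : covers P Q -> x \in Q -> x \notin P ->
  u \in Q -> exists a : A, u - x * a \in P.
Proof.
move=> [sPQ _ cov] Qx Px Qu.
have [||x1 a [b Pb]|J memJ] :=
  @right_ideal_of (fun u => exists a : A, u - x * a \in P).
- by exists 0; rewrite mulr0 subr0 right_ideal0.
- move=> v w [a Pa] [b Pb]; exists (a + b).
  by rewrite mulrDr opprD addrACA right_idealD.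
- by exists (b * a); rewrite mulrA -mulrBl right_idealM.
have [|y||] := cov J.
- by move=> y Py; apply/memJ; exists 0; rewrite mulr0 subr0.
- case/memJ=> a /sPQ Qa; rewrite -(subrK (x * a) y).
  by rewrite right_idealD // right_idealM.
- move/(_ x) => sJP; case/negP: Px; apply/sJP/memJ; exists 1.
  by rewrite mulr1 subrr right_ideal0.
- by move/(_ u Qu)/memJ.
Qed.
End RightIdeals.

(** The annihilator of the class of x in Q/P is a maximal right ideal, as Q/P is
simple and generated by that class. *)
Lemma colon_maximal (K : fieldType) (A : falgType K) (P Q : right_ideal A)
    (x : A) :
    covers P Q -> x \in Q -> x \notin P ->
  exists2 I : right_ideal A, maximal_right_ideal I &
    forall a : A, a \in I <-> x * a \in P.
Proof.
move=> PQ Qx Px.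
have [||y a Py|I memI] := @right_ideal_of A (fun a => x * a \in P).
- by rewrite mulr0 right_ideal0.
- by move=> a b; rewrite mulrDr; apply: right_idealD.
- by rewrite mulrA right_idealM.
exists I => //; split.
  by exists 1; apply/negP=> /memI; rewrite mulr1; apply/negP.
move=> J sIJ; case: (pselect {subset J <= I}) => [sJI|].
  by left=> a; apply/idP/idP; [apply: sJI | apply: sIJ].
move=> /not_right_ideal_sub[a Ja Ia]; right.
have Pxa : x * a \notin P by apply: contra Ia => /memI.
(* As x * a generates Q modulo P, some 1 - a * b lies in I; J contains both I
   and a, hence 1. *)
have [b Pb] := covers_generated PQ (right_idealM a Qx) Pxa Qx.
have /memI/sIJ J1 : x * (1 - a * b) \in P by rewrite mulrBr mulr1 mulrA.
move=> c; rewrite -[c]mul1r right_idealM // -(subrK (a * b) 1).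
by rewrite right_idealD // right_idealM.
Qed.

(** * Chains of right ideals in finite dimension *)

Section FiniteDimension.
Variables (K : fieldType) (A : falgType K).
Implicit Types (J : right_ideal A).

Lemma right_idealZ J (k : K) (x : A) : x \in J -> k *: x \in J.
Proof. by move=> Jx; rewrite -[x]mulr1 scalerAr right_idealM. Qed.

(** A right ideal is a linear subspace because scalars act as multiplication by
k *: 1; a subspace of maximal dimension among those inside J is all of J. *)
Lemma right_ideal_vspace J : exists V : {vspace A}, V =i J.
Proof.
pose P n := `[< exists V : {vspace A}, {subset V <= J} /\ \dim V = n >].
have P0 : exists n, P n.
  exists 0%N; apply/asboolP; exists 0%VS; split; last exact: dimv0.
  by move=> x; rewrite memv0 => /eqP->; apply: right_ideal0.
have Pmax n : P n -> (n <= \dim {:A})%N.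
  by move=> /asboolP[V [_ <-]]; rewrite dimvS // subvf.
case: (ex_maxnP P0 Pmax) => n /asboolP[V [sVJ dimV]] maxV.
exists V => x; apply/idP/idP => [/sVJ //|Jx].
have sVW : (V <= V + <[x]>)%VS by apply: addvSl.
suff -> : V = (V + <[x]>)%VS by rewrite (subvP (addvSr _ _)) ?memv_line.
apply/eqP; rewrite eqEdim sVW dimV; apply: maxV; apply/asboolP.
exists (V + <[x]>)%VS; split=> // _ /memv_addP[v Vv [_ /vlineP[k ->] ->]].
by apply: right_idealD; [apply: sVJ | apply: right_idealZ].
Qed.

Definition ideal_dim J : nat := \dim (sval (cid (right_ideal_vspace J))).

Lemma ideal_dim_le J : (ideal_dim J <= \dim {:A})%N.
Proof. by rewrite dimvS // subvf. Qed.

Lemma ideal_dim_sub J J' : {subset J <= J'} -> (ideal_dim J' <= ideal_dim J)%N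
  -> {subset J' <= J}.
Proof.
rewrite /ideal_dim => sJJ'.
case: cid => V' /= VJ'; case: cid => V /= VJ dimJ.
have /eqP eqV : V == V'.
  by rewrite eqEdim dimJ andbT; apply/subvP=> x; rewrite VJ VJ'; apply: sJJ'.
by move=> x; rewrite -VJ -VJ' eqV.
Qed.

Lemma right_ideal_max (P : right_ideal A -> Prop) J0 : P J0 ->
  exists2 J, P J & forall J', P J' -> {subset J <= J'} -> {subset J' <= J}.
Proof.
move=> PJ0; pose D n := `[< exists2 J, P J & ideal_dim J = n >].
have D0 : exists n, D n by exists (ideal_dim J0); apply/asboolP; exists J0.
have Dmax n : D n -> (n <= \dim {:A})%N.
  by move=> /asboolP[J _ <-]; apply: ideal_dim_le.
case: (ex_maxnP D0 Dmax) => n /asboolP[J PJ <-] maxJ.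
exists J => // J' PJ' sJJ'; apply: ideal_dim_sub => //.
by apply: maxJ; apply/asboolP; exists J'.
Qed.

Lemma right_ideal_min (P : right_ideal A -> Prop) J0 : P J0 ->
  exists2 J, P J & forall J', P J' -> {subset J' <= J} -> {subset J <= J'}.
Proof.
move=> PJ0; pose D n := `[< exists2 J, P J & ideal_dim J = n >].
have D0 : exists n, D n by exists (ideal_dim J0); apply/asboolP; exists J0.
case: (ex_minnP D0) => n /asboolP[J PJ <-] minJ.
exists J => // J' PJ' sJ'J; apply: ideal_dim_sub => //.
by apply: minJ; apply/asboolP; exists J'.
Qed.

Lemma covers_below (X : right_ideal A) :
  (exists2 x : A, x \in X & x != 0) -> exists Y, covers Y X.
Proof.
move=> [x Xx x0].
have [|||Z memZ] := @right_ideal_of A (fun u => u = 0) => //.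
- by move=> u v -> ->; rewrite addr0.
- by move=> u a ->; rewrite mul0r.
pose P J := {subset J <= X} /\ exists2 u : A, u \in X & u \notin J.
have [|Y [sYX nXY] maxY] := @right_ideal_max P Z.
  split=> [u /memZ->|]; first exact: right_ideal0.
  by exists x => //; apply/negP=> /memZ; apply/eqP.
exists Y; split=> // J sYJ sJX.
case: (pselect {subset X <= J}) => [|nXJ]; [by right | left].
apply: maxY => //; split=> //.
exact: not_right_ideal_sub.
Qed.

Lemma covers_above (X : right_ideal A) :
  (exists x : A, x \notin X) -> exists Z, covers X Z.
Proof.
move=> [x Xx].
have [|||T memT] := @right_ideal_of A (fun=> True) => //.
pose P J := {subset X <= J} /\ exists2 u : A, u \in J & u \notin X.
have [|Z [sXZ nZX] minZ] := @right_ideal_min P T.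
  by split=> [u _|]; [apply/memT | exists x => //; apply/memT].
exists Z; split=> // J sXJ sJZ.
case: (pselect {subset J <= X}) => [|nJX]; [by left | right].
apply: minZ => //; split=> //.
exact: not_right_ideal_sub.
Qed.

(** * Homomorphisms from an ideal of a local or symmetric algebra *)

(** Both X/Y, for a cover Y < X, and Z/X, for a cover X < Z, are the unique
simple module of A, which is therefore a quotient of X and a submodule of
A/X. *)
Lemma local_hom_nonzero (X : right_ideal A) : local_alg A ->
    (exists2 x : A, x \in X & x != 0) -> (exists x : A, x \notin X) ->
  exists (g : {linear submod X -> quotmod X}) u, g u != 0.
Proof.
move=> [I [_ uniqI]] /covers_below[Y YX] /covers_above[Z XZ].
have [sYX [x Xx Yx] _] := YX; have [sXZ [z Zz Xz] _] := XZ.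
(* Both annihilators are the unique maximal right ideal; one inclusion makes
   the class of x a |-> z a well defined. *)
have xz (a : A) : x * a \in Y -> z * a \in X.
  have [I1 /uniqI eqI1 memI1] := colon_maximal YX Xx Yx.
  have [I2 /uniqI eqI2 memI2] := colon_maximal XZ Zz Xz.
  by move=> Yxa; apply/(memI2 a).1; rewrite eqI2 -eqI1; apply/(memI1 a).2.
have coef (u : submod X) : exists a : A, (val u : A) - x * a \in Y.
  by apply: covers_generated YX Xx Yx _; apply: (valP u).
pose g0 (u : submod X) : quotmod X :=
  quotmod_pi X (z * sval (cid (coef u)) : A).
have g0E (u : submod X) a :
    (val u : A) - x * a \in Y -> g0 u = quotmod_pi X (z * a : A).
  rewrite /g0; case: cid => b /= Yb Ya; apply/quotmod_piP.
  have -> : (z * b : A) - z * a = z * (b - a) by rewrite mulrBr.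
  apply: xz; rewrite mulrBr; have := right_idealB Ya Yb.
  by rewrite opprB addrC addrA subrK.
have g0P : linear g0.
  move=> b u v; have [c Yc] := coef u; have [d Yd] := coef v.
  rewrite (g0E u c) // (g0E v d) // -linearP (g0E _ (c * (b : A) + d)).
    by rewrite mulrDr mulrA.
  rewrite right_ideal_valD right_ideal_valM.
  rewrite mulrDr mulrA opprD addrACA -mulrBl right_idealD //.
  exact: right_idealM.
pose g : {linear submod X -> quotmod X} :=
  HB.pack g0 (GRing.isLinear.Build _ _ _ _ g0 g0P).
exists g, (Sub x Xx : submod X).
rewrite /= (g0E _ 1) ?SubK ?mulr1 ?subrr ?right_ideal0 //.
by rewrite quotmod_pi_eq0.
Qed.

(** Let lambda = Phi 1 be the symmetrizing form, so that Phi a = lambda (a _).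
Extend the functional lambda o f from X to A by a linear projection onto X; it
then has the form lambda (a _).  For u in X and b in A this gives
lambda (f u * b) = lambda (f (u * b)) = lambda (a * u * b), so that
Phi (f u) = Phi (a * u), whence f u = a * u as Phi is injective. *)
Lemma symmetric_ideal_hom (X : right_ideal A) : symmetric_alg A ->
    forall f : submod X -> A,
    (forall u v, f (u + v) = f u + f v) ->
    (forall (b : A) u, f ((b : A^c) *: u) = f u * b) ->
  exists a : A, forall u, f u = a * (val u : A).
Proof.
move=> [Phi [/[dup] /bij_inj PhiI [Psi _ PsiK] PhiE]] f fD fM.
have PhiM (a y : A) : Phi a y = Phi 1 (a * y).
  by have := PhiE 1 1 a y; rewrite !mul1r mulr1.
have [V VX] := right_ideal_vspace X.
have projX y : projv V y \in submod_pred X by rewrite -[_ \in _]VX memv_proj.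
pose s y : submod X := Sub (projv V y : A) (projX y).
have sE (u : submod X) : s (val u) = u.
  by apply: val_inj; rewrite /= projv_id // VX; apply: (valP u).
pose g0 (y : A) : K^o := Phi 1 (f (s y)).
have g0P : linear g0.
  move=> k y z; rewrite /g0.
  have -> : s (k *: y + z) = (k%:A : A^c) *: s y + s z.
    apply: val_inj; rewrite /= linearP.
    by congr (_ + _); rewrite -[LHS]mulr1 -scalerAl scalerAr.
  by rewrite fD fM -scalerAr mulr1 linearP.
pose g : {linear A -> K^o} := HB.pack g0 (GRing.isLinear.Build _ _ _ _ g0 g0P).
exists (Psi (linfun g)) => u; apply/PhiI/lfunP => b.
rewrite PhiM [RHS]PhiM -mulrA -[RHS]PhiM PsiK lfunE /= /g0.
have -> : s ((val u : A) * b) = (b : A^c) *: u.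
  by rewrite -[RHS]sE right_ideal_valM.
by rewrite fM.
Qed.

End FiniteDimension.

Theorem corollary3p4 (K : fieldType) (A : falgType K)
    (A_connected : connected_alg A) (A_nss : ~ semisimple_alg A)
    (A_not_dual : ~ iso_dual_numbers A)
    (A_local : local_alg A) (A_sym : symmetric_alg A)
    (X : right_ideal A) (X_ideal : two_sided_ideal X)
    (X_neq0 : exists2 x : A, x \in X & x != 0)
    (X_neqA : exists x : A, x \notin X) :
  nonzero (ModHom (submod X) (quotmod X)) /\
  phi (submod X) = Some 1%N /\
  nonzero (Ext (submod X) (submod X) 1).
Proof.
have [g [u gu0]] := local_hom_nonzero A_local X_neq0 X_neqA.
have ext1 : nonzero (Ext (submod X) (submod X) 1).
  apply: (@ext1_nonzero A^c (submod X) (regular_right A) X g) => l lE.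
  have [|b v|a la] := symmetric_ideal_hom A_sym (f := l).
  - by move=> v w; apply: (raddfD l).
  - exact: (linearZ_LR l).
  have Xlu : (l u : A) \in X by rewrite la; apply/X_ideal/(valP u).
  by case/negP: gu0; rewrite -(lE u); apply: etrans (quotmod_pi_eq0 _ _) Xlu.
split; last split=> //.
  have g_hom : (g : _ -> _) \in @hom_pred _ (submod X) (quotmod X).
    by apply/asboolP; apply: linearP.
  exists (exist _ (g : _ -> _) g_hom); apply/negP=> /eqP/(congr1 val)/= g0.
  by case/negP: gu0; rewrite g0.
rewrite /phi; case: pselect => [ex|[]]; last first.
  by exists 1%N; rewrite /self_ext; apply/asboolP.
congr Some; case: ex_minnP => n /andP[n_gt0 _] /(_ 1%N) n_le1.
by apply/eqP; rewrite eqn_leq n_gt0 andbT n_le1 //; apply/asboolP.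
Qed.
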